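(* Let $E$ be an Archimedean sharply dominating effect algebra fulfilling the condition (W+). Then every element $x\in E$ is the sum of $\widetilde{x}$ and of the orthosum of a system of hypermeager elements; that is, there is an orthogonal system $G$ of hypermeager elements of $E$ whose orthosum $\bigoplus G$ exists and $x=\widetilde{x}\oplus\bigoplus G$.
   Context: An effect algebra is a partial algebra $(E;\oplus,0,1)$ with $0\neq 1$ and a partial binary operation $\oplus$ such that for all $x,y,z\in E$: (1) $x\oplus y=y\oplus x$ if $x\oplus y$ is defined; (2) $(x\oplus y)\oplus z=x\oplus(y\oplus z)$ if one side is defined; (3) for every $x$ there is a unique $y$ (denoted $x'$) with $x\oplus y=1$; (4) if $1\oplus x$ is defined then $x=0$. One writes $x\le y$ and $y\ominus x=z$ iff $x\oplus z$ is defined and equals $y$; $\le$ is a partial order. $E$ is Archimedean if for every nonzero $x\in E$ there is a greatest positive integer $n$ such that $nx=x\oplus\dots\oplus x$ ($n$ times) exists. A system $G=(x_\kappa)_{\kappa\in H}$ of not necessarily different elements of $E$ is orthogonal if for every finite subsystem $K$ of $G$ the sum $\bigoplus K$ exists (with $\bigoplus\emptyset=0$). Put $G^\oplus=\{\bigoplus K\mid K\subseteq G\text{ finite}\}$. The orthosum $\bigoplus G$ of an orthogonal system $G$ exists iff the supremum $\bigvee G^\oplus$ exists in $E$, and then $\bigoplus G=\bigvee G^\oplus$. $E$ fulfills the condition (W+) if for each orthogonal subset $A\subseteq E$ and each two upper bounds $u,v$ of $A^\oplus$ there exists an upper bound $w$ of $A^\oplus$ with $w\le u$ and $w\le v$.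 An element $x\in E$ is sharp if $x\wedge x'=0$; $\mathrm{S}(E)$ is the set of sharp elements. $E$ is sharply dominating if for every $x\in E$ there is a smallest sharp element $\widehat{x}$ above $x$; equivalently, for every $x\in E$ there is a greatest sharp element $\widetilde{x}$ below $x$. An element $x\in E$ is hypermeager if there is $y\in E$ with $x\le y$ and $x\le y'$. *)

(* Defs.v *)
From Stdlib Require Import List Permutation.
Import ListNotations.

Set Implicit Arguments.
Unset Strict Implicit.
Unset Printing Implicit Defensive.

Definition obind (A B : Type) (f : A -> option B) (o : option A) : option B :=
  match o with Some a => f a | None => None end.

(* The partial sum is option-valued, [None] meaning "undefined"; equality of
   options in [oplusC] and [oplusA] therefore says that one side is defined iff
   the other one is, and that the two values then agree.  The unique y with
   x (+) y = 1 is given as a function [compl]. *)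
Record effectAlgebra := EffectAlgebra {
  ea_sort :> Type;
  oplus : ea_sort -> ea_sort -> option ea_sort;
  zero : ea_sort;
  one : ea_sort;
  compl : ea_sort -> ea_sort;
  zero_neq_one : zero <> one;
  oplusC : forall x y, oplus x y = oplus y x;
  oplusA : forall x y z,
    obind (fun u => oplus u z) (oplus x y) = obind (oplus x) (oplus y z);
  oplus_compl : forall x, oplus x (compl x) = Some one;
  compl_unique : forall x y, oplus x y = Some one -> y = compl x;
  one_oplus : forall x, oplus one x <> None -> x = zero
}.

Arguments zero {e}.
Arguments one {e}.

Section EffectAlgebraTheory.
Variable E : effectAlgebra.
Implicit Types (x y z s u v w m : E) (S : E -> Prop).

Definition le x y : Prop := exists z, oplus x z = Some y.

Definition osum (l : list E) : option E :=
  fold_right (fun x acc => obind (oplus x) acc) (Some zero) l.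

(* The finite sums do not depend on the enumeration. *)
Lemma osum_perm (l l' : list E) : Permutation l l' -> osum l = osum l'.
Proof.
induction 1 as [|x l1 l2 _ IH|x y l1|l1 l2 l3 _ IH1 _ IH2]; simpl.
- reflexivity.
- rewrite IH; reflexivity.
- destruct (osum l1) as [s|]; simpl; [|reflexivity].
  rewrite <- !oplusA, (oplusC x y); reflexivity.
- rewrite IH1; exact IH2.
Qed.

Definition Archimedean : Prop :=
  forall x, x <> zero ->
    exists n : nat, 1 <= n /\ osum (repeat x n) <> None /\
      forall k : nat, osum (repeat x k) <> None -> k <= n.

Definition upper_bound S u : Prop := forall s, S s -> le s u.

Definition is_sup S u : Prop :=
  upper_bound S u /\ forall v, upper_bound S v -> le u v.

Definition is_meet x y m : Prop :=
  le m x /\ le m y /\ forall z, le z x -> le z y -> le z m.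

(* A system is a family G : H -> E.  Its finite subsystems are given by finite
   sets of indices, enumerated without repetition, so that equal members with
   different indices are summed separately. *)
Definition orthogonal (H : Type) (G : H -> E) : Prop :=
  forall l : list H, NoDup l -> osum (map G l) <> None.

Definition finite_sums (H : Type) (G : H -> E) : E -> Prop :=
  fun s => exists l : list H, NoDup l /\ osum (map G l) = Some s.

Definition is_orthosum (H : Type) (G : H -> E) s : Prop :=
  orthogonal G /\ is_sup (finite_sums G) s.

(* A subset of E is regarded as the system of its elements, indexed by itself. *)
Definition subset_system (A : E -> Prop) : {a : E | A a} -> E :=
  @proj1_sig E A.
Arguments subset_system A _ : clear implicits.

Definition condition_Wplus : Prop :=
  forall A : E -> Prop, orthogonal (subset_system A) ->
  forall u v,
    upper_bound (finite_sums (subset_system A)) u ->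
    upper_bound (finite_sums (subset_system A)) v ->
    exists w, upper_bound (finite_sums (subset_system A)) w /\
      le w u /\ le w v.

Definition sharp x : Prop := is_meet x (compl x) zero.

Definition smallest_sharp_above x s : Prop :=
  sharp s /\ le x s /\ forall z, sharp z -> le x z -> le s z.

Definition greatest_sharp_below x s : Prop :=
  sharp s /\ le s x /\ forall z, sharp z -> le z x -> le z s.

Definition sharply_dominating : Prop :=
  forall x, exists s, smallest_sharp_above x s.

Definition hypermeager x : Prop := exists y, le x y /\ le x (compl y).

End EffectAlgebraTheory.

Arguments subset_system {E} A _.

(* Main.v *)
(** Write [x = xt (+) m]; since sums of sharp elements are sharp here, [zero]
    is the only sharp element below [m], so every nonzero element below [m]
    has a nonzero hypermeager element below it.  By Zorn's lemma take a maximal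
    set [A] of multiples of hypermeager elements whose finite sums lie below [m]
    and which admits no second copy of any of its members.  If [u] bounds the
    finite sums of [A], then (W+) gives a bound [w] below [m] and [u].  If [w]
    were not [m], take a nonzero hypermeager [y] below the difference and the
    largest multiple [n y] that can be adjoined to [A]: it is a new element, and
    a second copy of it cannot be adjoined, contradicting maximality.  Hence
    [m = w <= u], and [m] is the orthosum of the hypermeager elements composing
    the members of [A].  The "no second copy" clause is what lets (W+), which
    concerns subsets, apply although systems may have repeated members. *)

From Stdlib Require Import List Permutation Lia.
From mathcomp Require Import boolp classical_sets.
Require Import Defs.
Import ListNotations.

Set Implicit Arguments.
Unset Strict Implicit.
Unset Printing Implicit Defensive.

(** * Lists without repetition, bounded sets of naturals, and chains of sets *)

Lemma incl_Permutation (T : Type) (l L : list T) :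
  NoDup l -> incl l L -> exists l', Permutation L (l ++ l').
Proof.
intros Hl; revert L; induction Hl as [|x l Hx _ IH]; intros L HL.
- exists L; apply Permutation_refl.
- destruct (in_split x L (HL x (or_introl eq_refl))) as [L1 [L2 ->]].
  destruct (IH (L1 ++ L2)) as [l' Hl'].
  + intros z Hz; specialize (HL z (or_intror Hz)).
    apply in_app_or in HL; apply in_or_app.
    destruct HL as [H|[H|H]]; auto; subst z; contradiction.
  + exists l'; simpl; apply Permutation_sym, Permutation_cons_app.
    apply Permutation_sym, Hl'.
Qed.

Lemma exists_max_nat (P : nat -> Prop) (N k : nat) :
  P k -> (forall i, P i -> i <= N) ->
  exists n, P n /\ forall i, P i -> i <= n.
Proof.
intros Pk; induction N as [|N IH]; intros HN.
- exists k; split; [exact Pk|intros i Hi; specialize (HN i Hi); lia].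
- destruct (EM (P (S N))) as [H|H]; [exists (S N); auto|].
  apply IH; intros i Hi; specialize (HN i Hi).
  assert (i <> S N) by (intros ->; contradiction); lia.
Qed.

Lemma sig_list (T : Type) (P : T -> Prop) (l : list T) :
  Forall P l -> exists l' : list {t : T | P t}, map (@proj1_sig T P) l' = l.
Proof.
induction 1 as [|t l Ht _ [l' IH]].
- now exists nil.
- exists (exist P t Ht :: l'); simpl; now rewrite IH.
Qed.

Lemma NoDup_map_proj1_sig (T : Type) (P : T -> Prop) (l : list {t | P t}) :
  NoDup l -> NoDup (map (@proj1_sig T P) l).
Proof.
apply FinFun.Injective_map_NoDup; intros [a Ha] [b Hb]; simpl; intros ->.
f_equal; apply Prop_irrelevance.
Qed.

Lemma Forall_proj1_sig (T : Type) (P : T -> Prop) (l : list {t | P t}) :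
  Forall P (map (@proj1_sig T P) l).
Proof. induction l as [|[a Ha] l IH]; constructor; auto. Qed.

(** Copies carry a number so that the enumeration has no repetitions, as the index lists of a system
    require. *)
Definition copies (T : Type) (n : T -> nat) (l : list T) : list (T * nat) :=
  flat_map (fun a => map (pair a) (seq 0 (n a))) l.

Lemma in_copies (T : Type) (n : T -> nat) (l : list T) (p : T * nat) :
  In p (copies n l) <-> In (fst p) l /\ snd p < n (fst p).
Proof.
unfold copies; rewrite in_flat_map; split.
- intros [a [Ha Hp]]; apply in_map_iff in Hp; destruct Hp as [i [<- Hi]].
  apply in_seq in Hi; simpl; split; [exact Ha|lia].
- destruct p as [a i]; simpl; intros [Ha Hi]; exists a; split; [exact Ha|].
  apply in_map, in_seq; lia.
Qed.

Lemma NoDup_copies (T : Type) (n : T -> nat) (l : list T) :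
  NoDup l -> NoDup (copies n l).
Proof.
induction 1 as [|a l Ha _ IH]; [constructor|].
apply NoDup_app.
- apply FinFun.Injective_map_NoDup; [intros i j; congruence|apply seq_NoDup].
- exact IH.
- intros p Hp Hp'; apply in_copies in Hp'; apply in_map_iff in Hp.
  destruct Hp as [i [<- _]]; simpl in Hp'; tauto.
Qed.

(** Of two links of a chain the larger contains the members found so far. The empty list is set
    apart because the chain may be empty. *)
Lemma bigcup_chain_list (T : Type) (F : set (set T)) (l : list T) :
  total_on F subset -> Forall (fun t => exists2 X, F X & X t) l ->
  l = nil \/ exists X, F X /\ Forall X l.
Proof.
intros HF; induction 1 as [|t l [X FX Xt] _ [-> |[Y [FY HY]]]]; auto; right.
- exists X; split; [exact FX|now repeat constructor].
- destruct (HF X Y FX FY) as [XY|YX].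
  + exists Y; split; [exact FY|constructor; auto].
  + exists X; split; [exact FX|constructor; auto].
    revert HY; apply Forall_impl; exact YX.
Qed.

(** * Arithmetic and order of an effect algebra *)

Section EffectAlgebra.
Variable E : effectAlgebra.
Implicit Types (x y z s u v w m : E) (l : list E).

Lemma oplusA_lr x y z u v :
  oplus x y = Some u -> oplus u z = Some v ->
  exists t, oplus y z = Some t /\ oplus x t = Some v.
Proof.
intros H1 H2; generalize (oplusA x y z); rewrite H1; simpl; rewrite H2.
destruct (oplus y z) as [t|]; simpl; [|discriminate].
intros H; now exists t.
Qed.

Lemma oplusA_rl x y z t v :
  oplus y z = Some t -> oplus x t = Some v ->
  exists u, oplus x y = Some u /\ oplus u z = Some v.
Proof.
rewrite (oplusC y), (oplusC x); intros H1 H2.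
destruct (oplusA_lr H1 H2) as [u [H3 H4]].
exists u; now rewrite (oplusC x), (oplusC u).
Qed.

Lemma complK x : compl (compl x) = x.
Proof. symmetry; apply compl_unique; rewrite oplusC; apply oplus_compl. Qed.

(** The last axiom makes [zero] the complement of [one]. Regrouping [(compl x (+) x) (+) zero = one]
    then shows that [x (+) zero] is the complement of [compl x]. *)
Lemma oplus0 x : oplus x zero = Some x.
Proof.
assert (H0 : compl one = zero :> E).
{ apply one_oplus; now rewrite oplus_compl. }
assert (H1 := oplus_compl (one : E)); rewrite H0 in H1.
assert (Hc : oplus (compl x) x = Some one) by (rewrite oplusC; apply oplus_compl).
destruct (oplusA_lr Hc H1) as [t [Ht Ht1]].
now rewrite Ht, (compl_unique Ht1), complK.
Qed.

(** Once [compl z] is added, both [y] and [t] are the complement of [compl z (+) x]. *)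
Lemma oplus_cancel x y z t :
  oplus x y = Some z -> oplus x t = Some z -> y = t.
Proof.
assert (K : forall q, oplus x q = Some z ->
  exists u, oplus (compl z) x = Some u /\ oplus u q = Some one).
{ intros q Hq; apply (oplusA_rl Hq); rewrite oplusC; apply oplus_compl. }
intros Hy Ht; destruct (K y Hy) as [u [Hu Huy]], (K t Ht) as [u' [Hu' Hut]].
assert (u = u') by congruence; subst u'.
now rewrite (compl_unique Huy), (compl_unique Hut).
Qed.

Lemma oplus_eq0 x y : oplus x y = Some zero -> x = zero.
Proof.
intros H; destruct (oplusA_rl H (oplus0 one)) as [u [Hu _]].
apply one_oplus; now rewrite Hu.
Qed.

Lemma le_refl x : le x x.
Proof. exists zero; apply oplus0. Qed.

Lemma le_trans x y z : le x y -> le y z -> le x z.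
Proof.
intros [p Hp] [q Hq]; destruct (oplusA_lr Hp Hq) as [t [_ Ht]]; now exists t.
Qed.

Lemma zero_le x : le zero x.
Proof. exists x; rewrite oplusC; apply oplus0. Qed.

Lemma le_zero x : le x zero -> x = zero.
Proof. intros [z Hz]; exact (oplus_eq0 Hz). Qed.

Lemma oplus_lel x y z : oplus x y = Some z -> le x z.
Proof. now exists y. Qed.

Lemma oplus_ler x y z : oplus x y = Some z -> le y z.
Proof. rewrite oplusC; apply oplus_lel. Qed.

Lemma le_antisym x y : le x y -> le y x -> x = y.
Proof.
intros [p Hp] [q Hq]; destruct (oplusA_lr Hp Hq) as [t [Ht Hx]].
rewrite (oplus_cancel Hx (oplus0 x)) in Ht.
rewrite (oplus_eq0 Ht), oplus0 in Hp; congruence.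
Qed.

Lemma oplus_le_compl x y s : oplus x y = Some s -> le x (compl y).
Proof.
rewrite oplusC; intros H; destruct (oplusA_lr H (oplus_compl s)) as [t [Ht Hy]].
exists (compl s); now rewrite Ht, (compl_unique Hy).
Qed.

Lemma le_compl x y : le x y -> le (compl y) (compl x).
Proof.
intros [z Hz]; destruct (oplusA_lr Hz (oplus_compl y)) as [t [Ht Hx]].
rewrite (compl_unique Hx) in Ht; exact (oplus_ler Ht).
Qed.

Lemma oplus_le_mono x y u v t :
  le x u -> le y v -> oplus u v = Some t ->
  exists s, oplus x y = Some s /\ le s t.
Proof.
intros [p Hp] [q Hq] Ht; rewrite oplusC in Hp.
destruct (oplusA_lr Hp Ht) as [a [Ha Hpa]].
destruct (oplusA_rl Hq Ha) as [b [Hb Hbq]].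
exists b; split; [exact Hb|].
exact (le_trans (oplus_lel Hbq) (oplus_ler Hpa)).
Qed.

(** * Sharp and hypermeager elements *)

Lemma sharp_compl x : sharp x -> sharp (compl x).
Proof.
unfold sharp; rewrite complK; intros [H1 [H2 H3]]; repeat split; auto.
Qed.

Lemma sharpP x : sharp x <-> forall z, le z x -> le z (compl x) -> z = zero.
Proof.
split.
- intros [_ [_ H]] z Hx Hc; apply le_zero; auto.
- intros H; split; [apply zero_le|split; [apply zero_le|]].
  intros z Hx Hc; rewrite (H z Hx Hc); apply le_refl.
Qed.

Lemma not_sharp_hypermeager x :
  ~ sharp x -> exists y, y <> zero /\ hypermeager y /\ le y x.
Proof.
intros Hx; apply contrapT; intros H; apply Hx, sharpP; intros z Hz Hz'.
apply contrapT; intros Hz0; apply H; exists z; repeat split; auto.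
(* The element [z] lies below [x] and [compl x], so [x] itself witnesses that [z] is hypermeager. *)
now exists x.
Qed.

(** Complementation reverses the order and preserves sharpness, so the complement of the smallest
    sharp element above [compl x] serves. *)
Lemma greatest_sharp_below_exists x :
  sharply_dominating E -> exists s, greatest_sharp_below x s.
Proof.
intros H; destruct (H (compl x)) as [s [Hs [Hxs Hmin]]].
exists (compl s); split; [now apply sharp_compl|split].
- rewrite <- (complK x); now apply le_compl.
- intros z Hz Hzx; rewrite <- (complK z).
  apply le_compl, Hmin; [now apply sharp_compl|now apply le_compl].
Qed.

(** The greatest sharp element [z] below [v] dominates both summands. Sharpness of [u] forces the
    remainder of [v] over [z] to vanish, hence [v = z]. *)
Lemma sharp_oplus s u v :
  sharply_dominating E -> sharp s -> sharp u -> oplus s u = Some v -> sharp v.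
Proof.
intros HD Hs Hu Hv.
destruct (greatest_sharp_below_exists v HD) as [z [Hz [[r Hr] Hmax]]].
destruct (Hmax s Hs (oplus_lel Hv)) as [a Ha].
assert (Huz : le u z) by exact (Hmax u Hu (oplus_ler Hv)).
(* The difference [r] of [v] and [z] lies below both [u] and [compl u]. *)
destruct (oplusA_lr Ha Hr) as [t [Ht Hst]].
rewrite (oplus_cancel Hst Hv) in Ht.
assert (r = zero).
{ apply (proj1 (sharpP u) Hu); [exact (oplus_ler Ht)|].
  rewrite oplusC in Hr.
  exact (le_trans (oplus_le_compl Hr) (le_compl Huz)). }
subst r; rewrite oplus0 in Hr; congruence.
Qed.

(** * Finite sums and bounds on them *)

Lemma osum_app l1 l2 s1 s2 :
  osum l1 = Some s1 -> osum l2 = Some s2 -> osum (l1 ++ l2) = oplus s1 s2.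
Proof.
revert s1; induction l1 as [|x l1 IH]; simpl; intros s1 H1 H2.
- injection H1 as <-; now rewrite H2, oplusC, oplus0.
- destruct (osum l1) as [s|]; simpl in H1; [|discriminate].
  rewrite (IH s eq_refl H2), <- oplusA, H1; reflexivity.
Qed.

Lemma osum_app_inv l1 l2 t :
  osum (l1 ++ l2) = Some t ->
  exists s1 s2, osum l1 = Some s1 /\ osum l2 = Some s2 /\ oplus s1 s2 = Some t.
Proof.
revert t; induction l1 as [|x l1 IH]; simpl; intros t H.
- exists zero, t; repeat split; auto; rewrite oplusC; apply oplus0.
- destruct (osum (l1 ++ l2)) as [s|] eqn:Hs; simpl in H; [|discriminate].
  destruct (IH s eq_refl) as [s1 [s2 [H1 [H2 H12]]]].
  destruct (oplusA_rl H12 H) as [u [Hu Hut]].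
  exists u, s2; repeat split; auto; now rewrite H1.
Qed.

(** Existence and bound are joined, so that orthogonality and boundedness of a system become a
    single condition. *)
Definition sum_le l m := exists s, osum l = Some s /\ le s m.

Lemma sum_le_perm l1 l2 m : Permutation l1 l2 -> sum_le l1 m -> sum_le l2 m.
Proof. unfold sum_le; intros H; now rewrite (osum_perm H). Qed.

Lemma sum_le_appl l1 l2 m : sum_le (l1 ++ l2) m -> sum_le l1 m.
Proof.
intros [t [Ht Htm]]; destruct (osum_app_inv Ht) as [s1 [s2 [H1 [_ H]]]].
exists s1; split; [exact H1|exact (le_trans (oplus_lel H) Htm)].
Qed.

Lemma sum_le_group l l1 x m :
  osum l1 = Some x -> sum_le (l ++ l1) m <-> sum_le (x :: l) m.
Proof.
intros Hx; split; intros [t [Ht Htm]]; exists t; split; auto.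
- destruct (osum_app_inv Ht) as [s1 [s2 [H1 [H2 H]]]]; simpl.
  rewrite H1; simpl; rewrite oplusC; congruence.
- simpl in Ht; destruct (osum l) as [s|] eqn:Hs; simpl in Ht; [|discriminate].
  rewrite (osum_app Hs Hx), oplusC; exact Ht.
Qed.

(** * Systems with bounded sums, and replacing members by copies *)

Definition sums_le (T : Type) (P : T -> Prop) (F : T -> E) m :=
  forall l : list T, NoDup l -> Forall P l -> sum_le (map F l) m.

Lemma sums_leP (T : Type) (P : T -> Prop) (F : T -> E) m :
  let G := fun k : {t | P t} => F (proj1_sig k) in
  sums_le P F m <-> orthogonal G /\ upper_bound (finite_sums G) m.
Proof.
intros G.
assert (K : forall l : list {t | P t}, map G l = map F (map (@proj1_sig T P) l)).
{ intros l; now rewrite map_map. }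
split.
- intros H.
  assert (H' : forall l : list {t | P t}, NoDup l -> sum_le (map G l) m).
  { intros l Hl; rewrite K.
    apply H; [now apply NoDup_map_proj1_sig|apply Forall_proj1_sig]. }
  split.
  + intros l Hl; destruct (H' l Hl) as [s [-> _]]; discriminate.
  + intros s [l [Hl Hs]]; destruct (H' l Hl) as [t [Ht Htm]]; congruence.
- intros [HO HU] l Hl HP; destruct (sig_list HP) as [l' <-].
  apply NoDup_map_inv in Hl; rewrite <- K.
  destruct (osum (map G l')) as [s|] eqn:Hs; [|now destruct (HO l' Hl)].
  exists s; split; [exact Hs|apply HU; now exists l'].
Qed.

Lemma osum_copies (y : E -> E) (n : E -> nat) l :
  Forall (fun a => osum (repeat (y a) (n a)) = Some a) l ->
  osum (map (fun p => y (fst p)) (copies n l)) = osum l.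
Proof.
induction 1 as [|a l Ha _ IH]; [reflexivity|].
unfold copies; simpl; fold (copies n l).
rewrite map_app, map_map; simpl; rewrite map_const, length_seq.
destruct (osum l) as [s|] eqn:Hs; simpl; [exact (osum_app Ha IH)|].
destruct (osum (_ ++ _)) as [t|] eqn:Ht; [|reflexivity].
destruct (osum_app_inv Ht) as [s1 [s2 [_ [H2 _]]]]; congruence.
Qed.

(** Any finite set of copies extends to the full blocks of finitely many members of [A], whose sum
    is a sum of members. Conversely, a sum of members is a sum of full blocks. *)
Lemma sums_le_copies (A : E -> Prop) (y : E -> E) (n : E -> nat) m :
  (forall a, A a -> osum (repeat (y a) (n a)) = Some a) ->
  sums_le A id m <->
  sums_le (fun p => A (fst p) /\ snd p < n (fst p)) (fun p => y (fst p)) m.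
Proof.
intros Hy; split; intros H l Hl HA; rewrite Forall_forall in HA.
(* [L] lists once each member of [A] that has a copy in [l]; [pselect] supplies classical
   decidability of equality. *)
- set (L := nodup (fun a b : E => pselect (a = b)) (map fst l)).
  assert (HL : Forall A L).
  { apply Forall_forall; intros a Ha; apply nodup_In, in_map_iff in Ha.
    destruct Ha as [p [<- Hp]]; now apply HA. }
  assert (HlL : incl l (copies n L)).
  { intros p Hp; apply in_copies; split; [|now apply HA].
    now apply nodup_In, in_map. }
  destruct (incl_Permutation Hl HlL) as [l' Hl'].
  apply (@sum_le_appl _ (map (fun p => y (fst p)) l')); rewrite <- map_app.
  apply (sum_le_perm (Permutation_map _ Hl')).
  unfold sum_le; rewrite osum_copies.
  + rewrite <- (map_id L); apply H; [apply NoDup_nodup|exact HL].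
  + revert HL; apply Forall_impl; exact Hy.
- unfold sum_le; rewrite map_id, <- (@osum_copies y n).
  + apply H; [now apply NoDup_copies|].
    apply Forall_forall; intros p Hp; apply in_copies in Hp.
    split; [apply HA|]; tauto.
  + apply Forall_forall; auto.
Qed.

(** * Maximal sets of multiples of hypermeager elements *)

Record saturated m (A : set E) : Prop := Saturated {
  saturated_le : sums_le A id m;
  saturated_mult : forall a, A a ->
    exists y n, hypermeager y /\ osum (repeat y n) = Some a;
  saturated_full : forall a, A a ->
    exists l, NoDup l /\ Forall A l /\ ~ sum_le (a :: l) m }.

(** Zorn applies because every clause of [saturated] concerns one member or finitely many, and a
    list that witnesses [saturated_full] remains a witness in any larger set. *)
Lemma exists_maximal_saturated m :
  exists A, saturated m A /\ forall B, proper A B -> ~ saturated m B.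
Proof.
apply (@Zorn_bigcup E (saturated m)); intros F HF Htot; split.
- intros l Hl HA; destruct (bigcup_chain_list Htot HA) as [-> |[X [FX HX]]].
  + exists zero; split; [reflexivity|apply zero_le].
  + exact (saturated_le (HF X FX) Hl HX).
- intros a [X FX Xa]; exact (saturated_mult (HF X FX) Xa).
- intros a [X FX Xa]; destruct (saturated_full (HF X FX) Xa) as [l [H1 [H2 H3]]].
  exists l; repeat split; auto; revert H2; apply Forall_impl; intros b Xb; now exists X.
Qed.

Lemma saturated_extend m (A : set E) y :
  Archimedean E -> saturated m A -> hypermeager y -> y <> zero ->
  (forall l, NoDup l -> Forall A l -> sum_le (y :: l) m) ->
  exists B, proper A B /\ saturated m B.
Proof.
intros HArch [HA HAmult HAfull] Hy Hy0 Hym.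
set (P := fun n => forall l, NoDup l -> Forall A l ->
            sum_le (l ++ repeat y n) m).
assert (P1 : P 1).
{ intros l Hl HlA; apply (proj2 (sum_le_group l m (oplus0 y : osum [y] = Some y))); auto. }
(* The empty list shows that [P i] makes the [i]-fold multiple of [y] exist, so the Archimedean
   bound [N] also bounds [P]. *)
destruct (HArch y Hy0) as [N [_ [_ HN]]].
destruct (@exists_max_nat P N 1 P1) as [n [Pn Hmax]].
{ intros i Hi; apply HN.
  destruct (Hi nil (NoDup_nil _) (Forall_nil _)) as [s [Hs _]].
  simpl in Hs; congruence. }
assert (n1 : 1 <= n) by auto.
destruct (Pn nil (NoDup_nil _) (Forall_nil _)) as [z [Hz _]]; simpl in Hz.
assert (Hzl : forall l, NoDup l -> Forall A l -> sum_le (z :: l) m).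
{ intros l Hl HlA; apply (proj1 (sum_le_group l m Hz)); auto. }
assert (HzA : ~ A z).
{ intros Az; destruct (HAfull z Az) as [l [H1 [H2 H3]]]; auto. }
assert (Hzz : exists l, NoDup l /\ Forall A l /\ ~ sum_le (z :: z :: l) m).
{ apply contrapT; intros H.
  (* If two copies of [z] could always be adjoined, so could [n + n] copies of [y], against the
     maximality of [n >= 1]. *)
  assert (P (n + n)) as H2.
  { intros l Hl HlA; rewrite repeat_app, app_assoc.
    apply (proj2 (sum_le_group _ m Hz)).
    apply (@sum_le_perm ((z :: l) ++ repeat y n)); [apply Permutation_refl|].
    apply (proj2 (sum_le_group _ m Hz)).
    apply contrapT; intros H3; apply H; now exists l. }
  specialize (Hmax _ H2); lia. }
exists (fun a => A a \/ a = z); split; [|split].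
- split; [now left|intros H; apply HzA, H; now right].
- intros l Hl HlA; rewrite map_id.
  (* If [z] occurs in [l], it is moved to the front and the other entries lie in [A]; otherwise all
     entries do. *)
  destruct (EM (In z l)) as [Hzin|Hzin].
  + destruct (in_split z l Hzin) as [l1 [l2 ->]].
    destruct (NoDup_remove _ _ _ Hl) as [Hl12 Hz12].
    apply (sum_le_perm (Permutation_middle l1 l2 z)), Hzl; [exact Hl12|].
    apply Forall_forall; intros a Ha; rewrite Forall_forall in HlA.
    destruct (HlA a) as [| ->]; auto; [|contradiction].
    apply in_app_or in Ha; apply in_or_app; simpl; tauto.
  + rewrite <- (map_id l); apply HA; [exact Hl|].
    apply Forall_forall; intros a Ha; rewrite Forall_forall in HlA.
    destruct (HlA a Ha) as [| ->]; auto; contradiction.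
- intros a [Aa| ->]; [auto|]; now exists y, n.
- intros a [Aa| ->].
  + destruct (HAfull a Aa) as [l [H1 [H2 H3]]]; exists l; repeat split; auto.
    revert H2; apply Forall_impl; auto.
  (* The first of the two copies of [z] now belongs to the enlarged set, so [z :: l] is a list to
     which the second cannot be added. *)
  + destruct Hzz as [l [H1 [H2 H3]]]; exists (z :: l); repeat split; auto.
    * constructor; [|exact H1]; rewrite Forall_forall in H2; auto.
    * constructor; [now right|]; revert H2; apply Forall_impl; auto.
Qed.

(** * Orthosums of hypermeager elements *)

Lemma meager_orthosum m :
  Archimedean E -> condition_Wplus E ->
  (forall s, sharp s -> le s m -> s = zero) ->
  exists (H : Type) (G : H -> E),
    (forall k, hypermeager (G k)) /\ is_orthosum G m.
Proof.
intros HArch HW Hm.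
destruct (exists_maximal_saturated m) as [A [HA Hmax]].
assert (Hyn : forall a, exists p : E * nat,
  A a -> hypermeager (fst p) /\ osum (repeat (fst p) (snd p)) = Some a).
{ intros a; destruct (EM (A a)) as [Aa|Aa].
  - destruct (saturated_mult HA Aa) as [y [n H]]; now exists (y, n).
  - exists (zero, 0); contradiction. }
destruct (choice Hyn) as [f Hf].
assert (Hf2 : forall a, A a -> osum (repeat (fst (f a)) (snd (f a))) = Some a).
{ intros a Aa; now apply Hf. }
(* The system consists of the hypermeager parts of the members of [A]: the pair [(a, i)] indexes
   copy [i] of the part whose multiple is [a]. *)
set (B := fun p : E * nat => A (fst p) /\ snd p < snd (f (fst p))).
set (F := fun p : E * nat => fst (f (fst p))).
assert (HAB : forall u, sums_le A id u <-> sums_le B F u).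
{ intros u; exact (sums_le_copies u Hf2). }
destruct (proj1 (sums_leP B F m) (proj1 (HAB m) (saturated_le HA))) as [HO HU].
exists {p | B p}, (fun k => F (proj1_sig k)); split; [|split; [exact HO|split]].
- intros [p Hp]; now apply Hf, Hp.
- exact HU.
- intros u Hu.
  (* The bound [u] is carried over from the system of copies to the set [A], to which (W+)
     applies. *)
  assert (HuA : sums_le A id u) by (apply HAB, sums_leP; auto).
  destruct (proj1 (sums_leP A id m) (saturated_le HA)) as [HOA HmA].
  apply sums_leP in HuA; destruct HuA as [_ HuA].
  destruct (HW A HOA m u HmA HuA) as [w [Hw [[d Hd] Hwu]]].
  assert (HwA : sums_le A id w) by (apply sums_leP; auto).
  enough (d = zero) as ->.
  { rewrite oplus0 in Hd; injection Hd as ->; exact Hwu. }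
  apply contrapT; intros Hd0.
  destruct (@not_sharp_hypermeager d) as [y [Hy0 [Hy Hyd]]].
  { intros Hs; apply Hd0, Hm; [exact Hs|exact (oplus_ler Hd)]. }
  destruct (saturated_extend HArch HA Hy Hy0) as [C [AC HC]].
  (* A sum [s] of members of [A] lies below [w] and [y] lies below [d], so [s (+) y] exists below
     [w (+) d = m]. *)
  { intros l Hl HlA; destruct (HwA l Hl HlA) as [s [Hs Hsw]].
    rewrite map_id in Hs; unfold sum_le; simpl; rewrite Hs; simpl.
    rewrite oplusC; exact (oplus_le_mono Hsw Hyd Hd). }
  exact (Hmax C AC HC).
Qed.

End EffectAlgebra.

Theorem corollary3p5 (E : effectAlgebra)
  (hArch : Archimedean E)
  (hSD : sharply_dominating E)
  (hW : condition_Wplus E)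
  (x : E) :
  exists xt : E, greatest_sharp_below x xt /\
  exists (H : Type) (G : H -> E),
    orthogonal G /\
    (forall k : H, hypermeager (G k)) /\
    exists g : E, is_orthosum G g /\ oplus xt g = Some x.
Proof.
destruct (greatest_sharp_below_exists x hSD) as [xt Hxt].
exists xt; split; [exact Hxt|].
destruct Hxt as [Hs [[m Hm] Hmax]].
destruct (@meager_orthosum E m hArch hW) as [H [G [HG HGm]]].
(* For sharp [s] below [m], the sum of [xt] and [s] is sharp and below [x]. By the choice of [xt] it
   equals [xt], and cancellation gives [s = zero]. *)
- intros s Ss Hsm.
  destruct (oplus_le_mono (le_refl xt) Hsm Hm) as [t [Ht Htx]].
  assert (Htxt : le t xt) by exact (Hmax t (sharp_oplus hSD Hs Ss Ht) Htx).
  rewrite (le_antisym Htxt (oplus_lel Ht)) in Ht.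
  exact (oplus_cancel Ht (oplus0 xt)).
- exists H, G; split; [apply HGm|split; [exact HG|]].
  now exists m.
Qed.
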